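(* Assume that there is a family $\{p_\alpha:\alpha<\mathfrak c\}$ of $P$-points on $\omega$, each of character $\omega_1$, such that for every nonprincipal ultrafilter $u$ on $\omega$ there are a finite-to-one function $f:\omega\to\omega$ and an $\alpha<\mathfrak c$ with $f(u)=p_\alpha$. Then there is a separable, sequentially compact Hausdorff space of cardinality $\mathfrak c$ that is not $p$-compact for any nonprincipal ultrafilter $p$ on $\omega$.
   Context: $\mathfrak c=2^{\aleph_0}$. A $P$-point is a nonprincipal ultrafilter $p$ on $\omega$ such that for every countable family $\{A_n:n\in\omega\}\subseteq p$ there is $A\in p$ with $A\setminus A_n$ finite for all $n$. The character of an ultrafilter is the least cardinality of a subfamily generating it (a base). For $f:\omega\to\omega$ and an ultrafilter $u$ on $\omega$, $f(u)=\{B\subseteq\omega: f^{-1}(B)\in u\}$; $f$ is finite-to-one if each $f^{-1}(\{n\})$ is finite. A space is sequentially compact if every sequence in it has a convergent subsequence. A point $x\in X$ is a $p$-limit of a sequence $(x_n)_{n\in\omega}$ in $X$ if $\{n:x_n\in U\}\in p$ for every neighborhood $U$ of $x$; $X$ is $p$-compact if every sequence $\omega\to X$ has a $p$-limit in $X$. *)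

(* Defs.v *)
From mathcomp Require Import all_boot all_order all_algebra.
From mathcomp Require Import all_classical.
From mathcomp Require Import topology.
From mathcomp Require Import wochoice.

Set Implicit Arguments.
Unset Strict Implicit.
Unset Printing Implicit Defensive.

Local Open Scope classical_set_scope.
Local Open Scope card_scope.

Definition nonprincipal_ultrafilter (u : set_system nat) : Prop :=
  UltraFilter u /\ forall n : nat, u <> principal_filter n.

Definition P_point (u : set_system nat) : Prop :=
  nonprincipal_ultrafilter u /\
  forall A : nat -> set nat, (forall n, u (A n)) ->
    exists2 B : set nat, u B & forall n, finite_set (B `\` A n).

Definition finite_to_one (f : nat -> nat) : Prop :=
  forall n, finite_set (f @^-1` [set n]).

Definition card_continuum (T : Type) (A : set T) : Prop :=
  A #= [set: set nat].

(* |A| = omega_1: A carries a well-order of type omega_1, the first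
   uncountable ordinal, i.e. A is uncountable but all the initial segments
   of the order are countable. *)
Definition card_omega1 (T : Type) (A : set T) : Prop :=
  ~ countable A /\
  exists2 R : rel T, wo_chain R (mem A) &
    forall x, A x -> countable [set y | A y /\ R y x].

(* [filter_from B id] is the set of all supersets of members of B. *)
Definition ultrafilter_base (u : set_system nat) (B : set_system nat) : Prop :=
  filter_from B id = u.

(* The library has no type of cardinals: the character is represented by a
   base B of least cardinality. *)
Definition character_omega1 (u : set_system nat) : Prop :=
  exists B : set_system nat,
    [/\ ultrafilter_base u B,
        forall C : set_system nat, ultrafilter_base u C -> B #<= C &
        card_omega1 B].

Definition separable (X : topologicalType) : Prop :=
  exists2 D : set X, countable D & dense D.

Definition sequentially_compact (X : topologicalType) : Prop :=
  forall x : nat -> X, exists g : nat -> nat,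
    {homo g : m n / (m < n)%N} /\ exists l : X, x \o g @ \oo --> l.

(* [x @ p --> l] says that {n | x n \in U} is in p for all U in [nbhs l]. *)
Definition p_limit (X : topologicalType) (p : set_system nat)
    (x : nat -> X) (l : X) : Prop :=
  x @ p --> l.

Definition p_compact (p : set_system nat) (X : topologicalType) : Prop :=
  forall x : nat -> X, exists l : X, p_limit p x l.

(* Main.v *)
Require Import Defs.
From mathcomp Require Import finmap.
From mathcomp Require Import all_boot all_order all_algebra.
From HB Require Import structures.
From mathcomp Require Import all_classical.
From mathcomp Require Import topology.
From mathcomp Require Import wochoice.

(** Each of the P-points [p a] has character omega_1, so it is generated by a
    tower: a family [W a] of members of [p a] that is well-ordered by reverse
    almost inclusion in type omega_1 and has no infinite pseudo-intersection
    ([P_point_tower]). A tower alone already gives a separable, sequentially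
    compact Hausdorff space without the required limits: add to the discrete
    space omega one point per member S of the tower, and let the complement of
    S together with the points of the earlier members and of S itself be
    clopen. An infinite subset of omega has infinitely many elements outside
    some S; for the first such S, those elements converge to the point of S.
    But the sequence of all natural numbers has no [p a]-limit, since no
    complement of a member of [W a] belongs to [p a].

    To treat all the [p a] in a single space while keeping a countable dense
    set, these spaces are hung on the branches of the binary tree. The isolated
    points are the finite binary strings, the copy of omega used for [a] is the
    set of initial segments of a branch [c a], and distinct branches are almost
    disjoint. One extra point at infinity is the limit of the sequences that
    meet each of the pieces finitely often ([tree_sequentially_compact]). In
    the resulting space of size continuum, the sequence running along the
    branch [c a] stays in a clopen copy of the space of [W a], so it still has
    no [p a]-limit ([branch_no_p_limit]).

    Finally, if [f @ q = p a], then a q-limit of [x \o f] is a [p a]-limit of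
    [x]. As every nonprincipal ultrafilter q maps onto some [p a], the space is
    not q-compact. *)

Local Open Scope classical_set_scope.

(** * Infinite sets of natural numbers and nonprincipal ultrafilters *)

Lemma finite_nat_bounded (A : set nat) :
  finite_set A -> exists m, A `<=` [set n | (n < m)%N].
Proof.
move=> /finite_seqP[s ->]; exists (\max_(i <- s) i).+1 => n ns.
by rewrite /= ltnS; exact: (@leq_bigmax_seq _ s xpredT id n).
Qed.

Lemma finite_near (A : set nat) :
  finite_set A -> \forall n \near \oo, ~ A n.
Proof.
move=> /finite_nat_bounded[m Am]; exists m => // n /= mn /Am /=.
by rewrite ltnNge mn.
Qed.

Lemma infinite_enum (N : set nat) : infinite_set N ->
  exists2 g : nat -> nat, {homo g : m n / (m < n)%N} & forall n, N (g n).
Proof.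
move=> Ninf.
have /choice[f fP] m : exists n, N n /\ (m < n)%N.
  apply: contrapT => /forallNP no; apply: Ninf.
  apply: (sub_finite_set _ (finite_II m.+1)) => n Nn /=.
  by rewrite ltnS leqNgt; apply/negP => mn; exact: (no n).
exists (fun n => iter n.+1 f 0%N); last by move=> n; exact: (fP _).1.
by apply: homo_ltn => [? ? ?|n]; [exact: ltn_trans|exact: (fP _).2].
Qed.

Lemma homo_ltn_inj (g : nat -> nat) :
  {homo g : m n / (m < n)%N} -> injective g.
Proof.
by move=> gm m n gmn; case: (ltngtP m n) => // /gm; rewrite gmn ltnn.
Qed.

Lemma infinite_range (g : nat -> nat) (A : set nat) :
  injective g -> (forall n, A (g n)) -> infinite_set A.
Proof.
move=> ginj Ag fA; apply: infinite_nat.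
have -> : [set: nat] = g @^-1` A by apply/seteqP; split=> n // _; exact: Ag.
by apply: finite_preimage => //; exact: in2W.
Qed.

(** The witness is the set of terms of even index in an increasing enumeration
    of [A]. *)
Lemma infinite_split (A : set nat) : infinite_set A ->
  exists V, [/\ V `<=` A, infinite_set V & infinite_set (A `\` V)].
Proof.
move=> /infinite_enum[g /homo_ltn_inj ginj Ag].
exists [set g n.*2 | n in setT]; split => [_ [n _ <-]||]; first exact: Ag.
- by apply: (infinite_range (fun n => g n.*2)) => [m n /ginj/double_inj|n] //;
    exists n.
- apply: (infinite_range (fun n => g n.*2.+1)) => [m n /ginj[]/double_inj //|n].
  split=> [|[m _ /ginj/(congr1 odd)]]; first exact: Ag.
  by rewrite /= !odd_double.
Qed.

Definition almost_sub (A B : set nat) := finite_set (A `\` B).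

Lemma almost_sub_refl A : almost_sub A A.
Proof. by rewrite /almost_sub setDv; exact: finite_set0. Qed.

Lemma almost_sub_trans B A C :
  almost_sub A B -> almost_sub B C -> almost_sub A C.
Proof.
move=> AB BC; apply: (@sub_finite_set _ _ ((A `\` B) `|` (B `\` C))).
  by move=> n [An Cn]; have [Bn|Bn] := pselect (B n); [right|left].
by rewrite finite_setU.
Qed.

Lemma sub_almost_sub A B C : A `<=` B -> almost_sub B C -> almost_sub A C.
Proof. by move=> AB; apply: sub_finite_set => n [/AB Bn Cn]. Qed.

Lemma nonprincipal_infinite {u A} :
  nonprincipal_ultrafilter u -> u A -> infinite_set A.
Proof.
move=> [uU unp] uA /finite_seqP[s sA].
suff : forall s : seq nat, ~ u [set` s] by move/(_ s); rewrite -sA.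
move=> {A uA s sA}; elim=> [|n s IHs].
  by rewrite set_nil => /filter_ex[].
move=> uns; have [un|un] := in_ultra_setVsetC [set n] uU; last first.
  apply: IHs; apply: filterS (filterI uns un) => m [/=].
  by rewrite inE => /orP[/eqP ->|].
apply: (unp n); apply/seteqP; split=> A; last first.
  by move=> /principal_filterP An; apply: filterS un => _ ->.
move=> uA; apply/principal_filterP.
by have [_ [/= ->]] := filter_ex (filterI un uA).
Qed.

Lemma ultra_infinite_split {u A} : nonprincipal_ultrafilter u -> u A ->
  exists2 V, V `<=` A & u V /\ infinite_set (A `\` V).
Proof.
move=> unp uA; have [uU _] := unp.
have [V [VA Vinf AVinf]] := infinite_split A (nonprincipal_infinite unp uA).
have [uV|uV] := in_ultra_setVsetC V uU; first by exists V.
exists (A `\` V); first exact: subDsetl.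
split; first by rewrite setDE; exact: filterI.
apply: sub_infinite_set Vinf => n Vn; split=> [|[] //]; exact: VA.
Qed.

(** A nonprincipal ultrafilter contains at most one of two disjoint infinite
    halves of [A], so it contains the complement of one of them. *)
Lemma ultra_no_pseudo_intersection {u A} : nonprincipal_ultrafilter u ->
  infinite_set A -> exists2 b, u b & infinite_set (A `\` b).
Proof.
move=> [uU _] /infinite_split[V [VA Vinf AVinf]].
have [uV|uV] := in_ultra_setVsetC V uU; first by exists V.
exists (~` V) => //; apply: sub_infinite_set Vinf => n Vn.
by split=> [|/(_ Vn)] //; exact: VA.
Qed.

(** The same property as in the definition of a P-point, for a countable family
    that need not be presented as a sequence and may be empty. *)
Lemma P_point_countable {u F : set_system nat} :
  P_point u -> countable F -> F `<=` u -> exists2 A, u A & forall S, F S -> almost_sub A S.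
Proof.
move=> [[uU _] uP] /countable_injP[f finj] Fu.
pose A n := xget setT [set S | F S /\ f S = n].
have [|B uB BA] := uP A.
  by move=> n; rewrite /A; case: xgetP => [S -> [/Fu]|_] //; exact: filterT.
exists B => // S FS; suff <- : A (f S) = S by exact: BA.
rewrite /A; case: xgetP => [S' -> [FS' fS']|/(_ S)]; last by case.
by apply: finj => //; rewrite inE.
Qed.

(** * Towers *)

(** The order in question is reverse almost inclusion, for which the first
    member of [C] is its largest one up to finite sets. The order type omega_1
    enters through [tower_countable]: countably many members are bounded. In
    [tower_gap], the set [U] lies between [S] and its predecessors, up to finite
    sets: it is the trace of a sequence that will converge to the point of
    [S]. *)
Record tower (W : set_system nat) : Prop := Tower {
  tower_antisym : forall S S', W S -> W S' ->
    almost_sub S S' -> almost_sub S' S -> S = S';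
  tower_first : forall C, C `<=` W -> C !=set0 ->
    exists2 S, C S & forall S', C S' -> almost_sub S' S;
  tower_countable : forall C, C `<=` W -> countable C ->
    exists2 S, W S & forall S', C S' -> almost_sub S S';
  tower_gap : forall S, W S -> exists U, [/\ infinite_set U, U `<=` ~` S &
    forall S', W S' -> almost_sub S' S \/ almost_sub U S'];
  tower_split : forall A, infinite_set A ->
    exists2 S, W S & infinite_set (A `\` S)
}.

Section tower_of_P_point.
Variables (u B : set_system nat) (R : rel (set nat)).
Hypotheses (uP : P_point u) (uB : ultrafilter_base u B).
Hypotheses (Buncountable : ~ countable B) (Rwo : wo_chain R (mem B)).
Hypothesis Rcountable : forall x, B x -> countable [set y | B y /\ R y x].

(** The strict order is restricted to [B], which makes it well-founded on the
   whole type of sets of natural numbers. *)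
Let lt (x y : set nat) := [/\ B x, B y, R x y & x <> y].

Let Btri x y : B x -> B y -> [\/ lt x y, x = y | lt y x].
Proof.
move=> Bx By; have [->|xy] := pselect (x = y); first exact: Or32.
have /orP[Rxy|Ryx] : R x y || R y x.
- by apply: (wo_chainW Rwo); rewrite inE.
- by apply: Or31.
- by apply: Or33; split=> // /esym.
Qed.

Let lt_asym x y : lt x y -> ~ R y x.
Proof.
move=> [Bx By Rxy xy] Ryx; apply: xy.
by apply: (wo_chain_antisymmetric Rwo); rewrite ?inE// Rxy.
Qed.

Let B_first (A : set_system nat) : A `<=` B -> A !=set0 ->
  exists2 z, A z & forall y, A y -> z = y \/ lt z y.
Proof.
move=> AB [x Ax].
have [||z [[/set_mem Az zP] _]] := Rwo (mem A).
- by move=> y /set_mem/AB ?; rewrite inE.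
- by exists x; rewrite inE.
exists z => // y Ay.
have [|->|] := Btri z y (AB _ Az) (AB _ Ay); [by right|by left|].
by move/lt_asym; case; apply: zP; rewrite inE.
Qed.

Let lt_wf : well_founded lt.
Proof.
move=> x; apply: contrapT => xN.
have [||z zN zP] := B_first [set y | ~ Acc lt y].
- move=> y yN; apply: contrapT => By; apply: yN; constructor => z [] //.
- by exists x.
apply: zN; constructor => y yz; apply: contrapT => /zP[zy|].
  by case: yz => _ _ _; rewrite zy.
by move=> zy; apply: (lt_asym _ _ zy); case: yz.
Qed.

(** What is asked of the member [S] of the tower with index [b] when [F] is the
   family of the earlier members. Being a subset of [b] makes the tower generate
   [u]; the set [U] makes the tower strictly decreasing. *)
Let step (b : set nat) (F : set_system nat) (S : set nat) :=
  [/\ u S, S `<=` b, forall S', F S' -> almost_sub S S' &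
      exists U, [/\ infinite_set U, U `<=` ~` S &
        forall S', F S' -> almost_sub U S']].

(** A pseudo-intersection A of [F] in [u] splits into two infinite parts; the
   part V that is in [u] is used for [S], and the other one for [U]. *)
Let step_ex b F : countable F -> F `<=` u -> u b -> exists S, step b F S.
Proof.
move=> cF Fu ub; have [unp _] := uP; have [uU _] := unp.
have [A uA AF] := P_point_countable uP cF Fu.
have [V VA [uV AVinf]] := ultra_infinite_split unp uA.
exists (V `&` b); split.
- exact: filterI.
- exact: subIsetr.
- by move=> S' /AF; apply: sub_almost_sub => n [/VA].
- exists (A `\` V); split => // [n [_ Vn] [] //|S' /AF].
  by apply: sub_almost_sub => n [].
Qed.

Let chosen : set nat -> set nat :=
  Fix lt_wf (fun=> set nat) (fun b rec =>
    get (step b [set S | exists y (yb : lt y b), S = rec y yb])).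

Let before b : set_system nat := [set chosen y | y in lt^~ b].

Let chosenE b : chosen b = get (step b (before b)).
Proof.
rewrite {1}/chosen Fix_eq; last first.
  move=> x f g fg; congr (get (step x _)); apply/funext => S.
  by apply/propext; split=> -[y [yx ->]]; exists y, yx.
congr (get (step b _)); apply/seteqP; split=> S.
  by move=> [y [yb ->]]; exists y.
by move=> [y yb <-]; exists y, yb.
Qed.

Let chosenP b : B b -> step b (before b) (chosen b).
Proof.
move: b; apply: (well_founded_ind lt_wf) => b IHb Bb.
have Bu y : B y -> u y by move=> By; rewrite -uB; exists y.
suff /getPex : exists S, step b (before b) S by rewrite -chosenE.
apply: step_ex; last exact: Bu.
  apply: (card_le_trans (card_image_le _ _)).
  apply: sub_countable (Rcountable _ Bb); apply: subset_card_le.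
  by move=> y [].
by move=> _ [y yb <-]; have [By _ _ _] := yb; have [] := IHb y yb By.
Qed.

Let chosen_mono x y : lt x y -> almost_sub (chosen y) (chosen x).
Proof.
move=> xy; have [_ By _ _] := xy; have [_ _ H _] := chosenP y By.
by apply: H; exists x.
Qed.

Let chosen_strict x y : lt x y -> ~ almost_sub (chosen x) (chosen y).
Proof.
move=> xy yx; have [_ By _ _] := xy.
have [_ _ _ [U [Uinf Uy Ux]]] := chosenP y By.
apply: Uinf; apply: sub_finite_set (almost_sub_trans _ _ _ (Ux _ _) yx).
  by move=> n Un; split => //; exact: Uy.
by exists x.
Qed.

Let chosen_tower : tower (chosen @` B).
Proof.
split.
- move=> _ _ [x Bx <-] [y By <-] xy yx.
  by have [/chosen_strict|->|/chosen_strict] := Btri x y Bx By.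
- move=> C CW [_ /[dup] /CW[x Bx <-] Cx].
  have [||z [Bz Cz] zP] := B_first [set y | B y /\ C (chosen y)].
  + by move=> y [].
  + by exists x.
  exists (chosen z) => // S' /[dup] /CW[y By <-] Cy.
  have [->|/chosen_mono //] : z = y \/ lt z y by exact: zP.
  exact: almost_sub_refl.
- move=> C CW Ccount.
  pose d S := get [set b | B b /\ chosen b = S].
  have dP S : C S -> B (d S) /\ chosen (d S) = S.
    move=> /CW[b Bb bS]; apply: (@getPex _ [set b | B b /\ chosen b = S]).
    by exists b.
  (* Otherwise [B] is a countable union of countable initial segments. *)
  suff [b Bb bP] : exists2 b, B b & forall S, C S -> ~ lt b (d S).
    exists (chosen b); first by exists b.
    move=> S CS; have [BdS dS] := dP S CS; rewrite -dS.
    have [/(bP S CS)//|->|/chosen_mono //] := Btri b (d S) Bb BdS.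
    exact: almost_sub_refl.
  apply: contrapT => /forall2NP no; apply: Buncountable.
  apply: (@sub_countable _ _ _ (\bigcup_(S in C) [set y | B y /\ R y (d S)])).
    apply: subset_card_le => b Bb; have [//|] := no b.
    move=> /existsNP[S /not_implyP[CS /contrapT[_ _ bd _]]].
    by exists S.
  by apply: bigcup_countable => // S /dP[Bd _]; exact: Rcountable.
- move=> _ [x Bx <-]; have [_ _ _ [U [Uinf Ux UF]]] := chosenP x Bx.
  exists U; split => // _ [y By <-].
  have [xy|<-|yx] := Btri x y Bx By.
  + by left; exact: chosen_mono.
  + by left; exact: almost_sub_refl.
  + by right; apply: UF; exists y.
- move=> A /(ultra_no_pseudo_intersection uP.1)[c uc Ac].
  move: uc; rewrite -uB => -[b Bb bc]; exists (chosen b); first by exists b.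
  have [_ cb _ _] := chosenP b Bb.
  by apply: sub_infinite_set Ac => n [An cn]; split => // /cb/bc.
Qed.

Lemma P_point_base_tower : exists2 W, tower W & W `<=` u.
Proof.
by exists (chosen @` B) => // _ [b /chosenP[ub _ _ _] <-].
Qed.

End tower_of_P_point.

(** Transfinite recursion along a well-order of type omega_1 on a base: each
    stage has only countably many predecessors, so that the P-point property
    provides the next member. *)
Lemma P_point_tower {u} : P_point u -> character_omega1 u ->
  exists2 W, tower W & W `<=` u.
Proof.
by move=> uP [B [uB _ [Bunc [R Rwo Rc]]]]; exact: (P_point_base_tower u B R).
Qed.

(** * Topologies generated by a family of clopen sets *)

(** An alias that carries the topology whose subbase consists of the members of
    [B] and their complements. *)
Definition clopen_generated {T : Type} (B : set_system T) : Type := T.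

Section clopen_generated.
Variables (T : choiceType) (B : set_system T).
Local Notation X := (clopen_generated B).

HB.instance Definition _ := Choice.on X.
HB.instance Definition _ :=
  isSubBaseTopological.Build X (B `|` [set ~` A | A in B]) id.

Lemma open_clopen_generated (A : set X) :
  B A \/ B (~` A) -> open A.
Proof.
move=> BA; exists [set A]; last first.
  by rewrite predeqE => x; split=> [[_ ->]|Ax] //; exists A.
move=> _ ->; exists [fset A]%fset.
  move=> _ /fset1P ->; apply/mem_set.
  by case: BA => BA; [left|right; exists (~` A) => //; rewrite setCK].
rewrite predeqE => x; split=> [|Ax _ /fset1P -> //].
by apply; rewrite /= fset11.
Qed.

Lemma cvg_clopen_generated (F : set_system X) (x : X) : Filter F ->
  (forall A, B A -> (A x -> F A) /\ (~ A x -> F (~` A))) -> F --> x.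
Proof.
move=> FF BF N; rewrite (@nbhsE X) => -[_ [[C sC <-] [D CD Dx] sN]].
rewrite nbhs_filterE; apply: filterS sN _; apply: (@filterS _ _ _ D).
  by move=> y Dy; exists D.
have /sC [E sE IED] := CD; rewrite -IED; apply: filter_bigI => A AE.
have Ax : A x by move: Dx; rewrite -IED => /(_ A AE).
have /set_mem := sE _ AE.
move=> [/BF[/(_ Ax)] //|[A' /BF[_ BA'] A'A]].
by rewrite -A'A in Ax *; exact: BA'.
Qed.

(** Since the sets in [B] and their complements form a subbase, a sequence
    converges to [l] as soon as each of them that contains [l] contains almost
    all the terms; this is applied to the terms with index in [N]. *)
Lemma cvg_subsequence (x : nat -> X) (l : X) (N : set nat) :
    infinite_set N ->
    (forall A, B A -> (A l -> finite_set (N `&` [set n | ~ A (x n)])) /\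
                      (~ A l -> finite_set (N `&` [set n | A (x n)]))) ->
  exists2 g : nat -> nat, {homo g : m n / (m < n)%N} &
    (forall n, N (g n)) /\ x \o g @ \oo --> l.
Proof.
move=> /infinite_enum[g gm Ng] Nx; exists g => //; split=> //.
have nearg P : finite_set (N `&` [set n | P n]) ->
    \forall n \near \oo, ~ P (g n).
  move=> fP; have : finite_set (g @^-1` (N `&` [set n | P n])).
    by apply: finite_preimage => //; exact: in2W (homo_ltn_inj _ gm).
  by move=> /finite_near; apply: filterS => n nP Pgn; apply: nP.
apply: cvg_clopen_generated => A BA; split=> [/(Nx A BA).1|/(Nx A BA).2].
  by move=> /(nearg (fun n => ~ A (x n))); apply: filterS => n /contrapT.
by move=> /(nearg (fun n => A (x n))).
Qed.

Lemma hausdorff_clopen_generated :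
  (forall x y, x <> y -> exists2 A, B A & (A x /\ ~ A y) \/ (A y /\ ~ A x)) ->
  hausdorff_space X.
Proof.
move=> Bsep x y clxy; apply: contrapT => /Bsep[A BA Axy].
have oA : open (A : set X) by apply: open_clopen_generated; left.
have oCA : open (~` A : set X).
  by apply: open_clopen_generated; right; rewrite setCK.
case: Axy => -[Az nAz].
  have [z [Azz nAzz //]] := clxy A (~` A) (open_nbhs_nbhs (conj oA Az))
    (open_nbhs_nbhs (conj oCA nAz)).
have [z [nAzz Azz //]] := clxy (~` A) A (open_nbhs_nbhs (conj oCA nAz))
    (open_nbhs_nbhs (conj oA Az)).
Qed.

End clopen_generated.

(** * The tree of towers *)

Definition branch (c : set nat) (n : nat) : seq bool :=
  mkseq (fun i => `[< c i >]) n.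

Lemma size_branch c n : size (branch c n) = n.
Proof. exact: size_mkseq. Qed.

Lemma branch_inj c : injective (branch c).
Proof. by move=> m n /(congr1 size); rewrite !size_branch. Qed.

(** Two branches share no node above the level where they split. *)
Lemma branch_almost_disjoint c d : c <> d ->
  finite_set (range (branch c) `&` range (branch d)).
Proof.
move=> cd; have [k ck] : exists k, `[< c k >] != `[< d k >].
  apply: contrapT => /forallNP no; apply: cd; apply/funext => k.
  have /negP := no k; rewrite negbK => /eqP ckdk.
  by apply: propext; exact: asbool_eq_equiv ckdk.
apply: (@sub_finite_set _ _ (branch c @` `I_k.+1)); last first.
  by apply: finite_image; exact: finite_II.
move=> _ [[n _ <-] [m _ dcn]]; exists n => //=.
have mn : m = n by rewrite -(size_branch d m) dcn size_branch.
rewrite ltnS leqNgt; apply/negP => kn; move/negP: ck; apply; apply/eqP.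
by have := congr1 (nth false ^~ k) dcn; rewrite mn !nth_mkseq.
Qed.

Section tower_tree.
Variables (I : Type) (c : I -> set nat) (W : I -> set_system nat).
Hypotheses (c_inj : injective c) (W_tower : forall a, tower (W a)).

Inductive point : Type :=
  | Node of seq bool
  | Limit a S of W a S
  | Infinity.

HB.instance Definition _ := gen_eqMixin point.
HB.instance Definition _ := gen_choiceMixin point.

Let e a := branch (c a).

(** The piece of the space that belongs to [a]: the branch [c a] together with
    the limit points of the tower [W a]. *)
Definition strip (a : I) : set point := fun x =>
  match x with
  | Node s => range (e a) s
  | Limit b _ _ => b = a
  | Infinity => False
  end.

(** The initial segment of [strip a] up to the point of [S]: in the strip, seen
    as omega followed by the tower, it is the complement of [S] followed by the
    points of the members that precede [S] or equal it. *)
Definition cone (a : I) (S : set nat) : set point := fun x =>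
  match x with
  | Node s => (e a @` (~` S)) s
  | Limit b S' _ => b = a /\ almost_sub S S'
  | Infinity => False
  end.

Inductive clopens : set_system point :=
  | clopen_node s : clopens [set Node s]
  | clopen_strip a : clopens (strip a)
  | clopen_cone a S of W a S : clopens (cone a S).

Definition tree := clopen_generated clopens.
HB.instance Definition _ := Topological.on tree.

Lemma cone_strip a S : cone a S `<=` strip a.
Proof. by case=> [s [n _ <-]|b S' _ []|] //; exists n. Qed.

Lemma clopens_infinity A : clopens A -> ~ A Infinity.
Proof. by case=> [s|a|a S _] []. Qed.

Lemma eq_Limit a S S' (WS : W a S) (WS' : W a S') :
  S = S' -> Limit a S WS = Limit a S' WS'.
Proof. by move=> SS'; subst S'; rewrite (Prop_irrelevance WS WS'). Qed.

Lemma tree_hausdorff : hausdorff_space tree.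
Proof.
apply: hausdorff_clopen_generated => x y xy.
case: x y xy => [s|a S WS|] [t|b S' WS'|] xy //.
- exists [set Node s]; first exact: clopen_node.
  by left; split => // /esym.
- by exists [set Node s]; [exact: clopen_node|left; split=> [|[]]].
- by exists [set Node s]; [exact: clopen_node|left; split=> [|[]]].
- by exists [set Node t]; [exact: clopen_node|right; split=> [|[]]].
- have [ab|ab] := pselect (b = a); last first.
    by exists (strip a); [exact: clopen_strip|left].
  subst b; have [SS'|SS'] := pselect (almost_sub S S'); last first.
    exists (cone a S); first exact: clopen_cone.
    by left; split=> [|[]] //; split=> //; exact: almost_sub_refl.
  exists (cone a S'); first exact: clopen_cone.
  right; split=> [|[_ S'S]]; first by split=> //; exact: almost_sub_refl.
  by apply: xy; apply: eq_Limit; exact: (tower_antisym _ (W_tower a)).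
- by exists (strip a); [exact: clopen_strip|left; split=> [|[]]].
- by exists [set Node t]; [exact: clopen_node|right; split=> [|[]]].
- by exists (strip b); [exact: clopen_strip|right; split=> [|[]]].
Qed.

Lemma strip_almost_disjoint a b : a <> b -> finite_set (strip a `&` strip b).
Proof.
move=> ab; have cab : c a <> c b by move/c_inj.
apply: (@sub_finite_set _ _
    (Node @` (range (e a) `&` range (e b)))); last first.
  by apply: finite_image; exact: branch_almost_disjoint.
by case=> [s as_|d S WS [/= da db]|[] //]; [exists s|case: ab; rewrite -da].
Qed.

(** The difference has no limit point, and its nodes are those of the branch
    whose level is in [S' `\` S]. *)
Lemma cone_almost_mono a S S' : W a S' -> almost_sub S' S ->
  finite_set (cone a S `\` cone a S').
Proof.
move=> WS' S'S; apply: (@sub_finite_set _ _ ((Node \o e a) @` (S' `\` S))).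
  case=> [s [[n Sn <-] nS']|b T WT [[ba ST] nS']|[] //].
    exists n => //; split => //; apply: contrapT => S'n.
    by apply: nS'; exists n.
  by case: nS'; split=> //; exact: almost_sub_trans S'S ST.
exact: finite_image.
Qed.

Lemma finite_fibers_preimage {Y : Type} (x : nat -> Y) (A : set Y) :
  (forall y, finite_set [set n | x n = y]) -> finite_set A ->
  finite_set [set n | A (x n)].
Proof.
move=> xfin Afin.
have -> : [set n | A (x n)] = \bigcup_(y in A) [set n | x n = y].
  by apply/seteqP; split=> n => [An|[y Ay /= ->]] //; exists (x n).
exact: bigcup_finite.
Qed.

(** If infinitely many terms are nodes, then their levels form an infinite set,
    which is not almost contained in all the members of the tower. Otherwise
    infinitely many terms are limit points; they involve only countably many
    members of the tower, and these have an upper bound. *)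
Lemma cone_infinite (x : nat -> point) a :
    (forall y, finite_set [set n | x n = y]) ->
    infinite_set [set n | strip a (x n)] ->
  exists2 S, W a S & infinite_set [set n | cone a S (x n)].
Proof.
move=> xfin ainf.
pose N1 := [set n | range (Node \o e a) (x n)].
pose N2 := [set n | exists S WS, x n = Limit a S WS].
have : infinite_set N1 \/ infinite_set N2.
  apply: contrapT => /not_orP[/contrapT f1 /contrapT f2]; apply: ainf.
  apply: (@sub_finite_set _ _ (N1 `|` N2)); last by rewrite finite_setU.
  move=> n; rewrite /= /N1 /N2 /=.
  case: (x n) => [s [m _ <-]|b S WS /= ba|//]; first by left; exists m.
  by subst b; right; exists S, WS.
case=> Ninf.
  pose A := [set m | exists n, x n = Node (e a m)].
  have Ainf : infinite_set A.
    move=> fA; apply: Ninf; apply: (@sub_finite_set _ _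
      [set n | ((Node \o e a) @` A) (x n)]); last first.
      by apply: finite_fibers_preimage => //; exact: finite_image.
    by move=> n [m _ nm]; exists m => //; exists n.
  have [S WS ASinf] := tower_split _ (W_tower a) _ Ainf.
  exists S => // fin; apply: ASinf.
  pose level y := if y is Node s then size s else 0%N.
  apply: sub_finite_set (finite_image (level \o x) fin) => m [[n xn] Sm].
  exists n; last by rewrite /= xn /= size_branch.
  by rewrite /= xn; exists m.
have [|| S WS SP] := tower_countable _ (W_tower a)
    [set S | exists n WS, x n = Limit a S WS].
- by move=> S [n [WS _]].
- pose side y := if y is Limit _ X _ then X else set0.
  apply: (@sub_countable _ _ _ (range (side \o x))).
    apply: subset_card_le => S [n [WS xn]]; exists n => //.
    by rewrite /= xn.
  exact: (card_le_trans (card_image_le _ _)).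
exists S => //; apply: sub_infinite_set Ninf => n [S' [WS' xn]].
by rewrite /= xn; split=> //; apply: SP; exists n, WS'.
Qed.

(** A sequence that takes each value finitely often and meets each strip
    finitely often converges to infinity. If it meets [strip a] infinitely
    often, take the first [S] such that [cone a S] contains infinitely many
    terms: the cone of an earlier member contains only finitely many of them, so
    these terms converge to the point of [S]. *)
Lemma tree_sequentially_compact : sequentially_compact tree.
Proof.
move=> x.
suff [l [N [Ninf Nx]]] : exists l (N : set nat), infinite_set N /\
    forall A, clopens A -> (A l -> finite_set (N `&` [set n | ~ A (x n)])) /\
                           (~ A l -> finite_set (N `&` [set n | A (x n)])).
  have [g gm [_ gl]] := cvg_subsequence _ _ x l N Ninf Nx.
  by exists g; split=> //; exists l.
have [xfin|/existsNP[y yinf]] :=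
    pselect (forall y, finite_set [set n | x n = y]); last first.
  exists y, [set n | x n = y]; split=> // A _; split=> Ay.
    by apply: (sub_finite_set _ (@finite_set0 nat)) => n /= [->].
  by apply: (sub_finite_set _ (@finite_set0 nat)) => n /= [->].
have [a_fin|/existsNP[a ainf]] :=
    pselect (forall a, finite_set [set n | strip a (x n)]).
  exists Infinity, setT; split=> [|A]; first exact: infinite_nat.
  move=> cA; split=> [/(clopens_infinity _ cA)//|_].
  rewrite setTI.
  case: A / cA => [s|a|a S _]; [exact: xfin|exact: a_fin|].
  by apply: sub_finite_set (a_fin a) => n /cone_strip.
have [||S [WS Sinf] Smax] := tower_first _ (W_tower a)
    [set S | W a S /\ infinite_set [set n | cone a S (x n)]].
- by move=> S [].
- by have [S WS Sinf] := cone_infinite x a xfin ainf; exists S.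
exists (Limit a S WS), [set n | cone a S (x n)]; split=> //.
have other b : a <> b ->
    finite_set [set n | cone a S (x n) /\ strip b (x n)].
  move=> /strip_almost_disjoint/(finite_fibers_preimage x _ xfin).
  by apply: sub_finite_set => n [/cone_strip].
move=> _ [s|b|b S' WS'].
- split=> // _; apply: sub_finite_set (xfin (Node s)) => n [] //.
- split=> [/= -> |/= ab]; last exact: other.
  by apply: (sub_finite_set _ (@finite_set0 nat)) => n [/cone_strip].
- have [ab|ab] := pselect (a = b); last first.
    split=> [[/ab]//|_]; apply: sub_finite_set (other b ab).
    by move=> n [Sn /cone_strip].
  subst b; split=> [[_ S'S]|nS'S].
    by have := finite_fibers_preimage x _ xfin (cone_almost_mono _ _ _ WS' S'S).
  apply: contrapT => inf; apply: nS'S; split=> //; apply: Smax; split=> //.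
  by apply: sub_infinite_set inf => n [].
Qed.

(** The sequence follows the branch [c a] at the levels given by the gap of
    [S]; this is what makes the nodes accumulate at every limit point. *)
Lemma limit_node_sequence a S (WS : W a S) :
  exists g : nat -> nat,
    (Node \o e a \o g : nat -> tree) @ \oo --> (Limit a S WS : tree).
Proof.
have [U [Uinf US Uabove]] := tower_gap _ (W_tower a) S WS.
have other b : a <> b -> finite_set [set n | strip b (Node (e a n))].
  move=> ab; have cab : c a <> c b by move/c_inj.
  apply: sub_finite_set (finite_image size (branch_almost_disjoint _ _ cab)).
  by move=> n bn; exists (e a n); [split=> //; exists n|exact: size_branch].
suff /(cvg_subsequence _ _ _ _ _ Uinf)[g _ [_ gl]] : forall A, clopens A ->
    (A (Limit a S WS) -> finite_set (U `&` [set n | ~ A (Node (e a n))])) /\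
    (~ A (Limit a S WS) -> finite_set (U `&` [set n | A (Node (e a n))])).
  by exists g.
move=> _ [s|b|b S' WS'].
- split=> // _; apply: (@sub_finite_set _ _ [set size s]) => [n [_ [<-]] /=|].
    by rewrite size_branch.
  exact: finite_set1.
- split=> [/= <-|/= /other]; last by apply: sub_finite_set => n [].
  by apply: (sub_finite_set _ (@finite_set0 nat)) => n [_]; apply; exists n.
- have [ab|ab] := pselect (a = b); last first.
    split=> [[/ab]//|_]; apply: sub_finite_set (other b ab) => n [_].
    exact: cone_strip.
  subst b; split=> [[_ S'S]|nS'S].
    apply: sub_finite_set S'S => n [Un nS'n].
    split; last exact: US.
    by apply: contrapT => nS; apply: nS'n; exists n.
  have [S'S|US'] := Uabove S' WS'; first by case: nS'S.
  apply: sub_finite_set US' => n [Un [m mS' /branch_inj mn]].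
  by rewrite mn in mS'.
Qed.


(** The point at infinity is put in the dense set: this avoids having to choose
    the branches so that some infinite set of nodes is almost disjoint from all
    of them. *)
Lemma tree_separable : separable tree.
Proof.
exists (range Node `|` [set Infinity]).
  apply: (@sub_countable _ _ _ (range (oapp Node Infinity))); last first.
    by apply: (card_le_trans (card_image_le _ _)); exact: countableP.
  apply: subset_card_le => _ [[s _ <-]|->]; first by exists (Some s).
  by exists None.
move=> O [[s Os|a S WS OS|Oinf]] oO.
- by exists (Node s); split=> //; left; exists s.
- have [g gl] := limit_node_sequence a S WS.
  have /filter_ex[n On] : \forall n \near \oo, O (Node (e a (g n))).
    exact: gl _ (open_nbhs_nbhs (conj oO OS)).
  by exists (Node (e a (g n))); split=> //; left; exists (e a (g n)).
- by exists Infinity; split=> //; right.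
Qed.

(** Such a limit would be in the closed set [strip a]. It would not be a node,
    because [q] is nonprincipal. Nor would it be the point of some [S] in
    [W a]: the neighbourhood [cone a S] of that point contains only the terms
    with index in [~` S], which is not in [q]. *)
Lemma branch_no_p_limit a (q : set_system nat) (l : tree) :
    nonprincipal_ultrafilter q -> W a `<=` q ->
  ~ p_limit q (fun n => Node (e a n) : tree) l.
Proof.
move=> qnp Wq ql; have [qU _] := qnp.
have near_l A : clopens A -> A l -> q [set n | A (Node (e a n))].
  move=> cA Al; apply: (ql A); apply: open_nbhs_nbhs; split=> //.
  by apply: open_clopen_generated; left.
have near_Cl A : clopens A -> ~ A l -> q [set n | ~ A (Node (e a n))].
  move=> cA Al; apply: (ql (~` A)); apply: open_nbhs_nbhs; split=> //.
  by apply: open_clopen_generated; right; rewrite setCK.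
have : strip a l.
  apply: contrapT => /(near_Cl _ (clopen_strip a))/filter_ex[n]; apply.
  by exists n.
case: l {ql} near_l near_Cl => [s|b S WS|] near_l _ //= => [_|ba].
  have := near_l _ (clopen_node s) erefl.
  move=> /(nonprincipal_infinite qnp); apply.
  apply: sub_finite_set (finite_set1 (size s)) => n [<-].
  by rewrite /= size_branch.
subst b; have := near_l _ (clopen_cone a S WS).
move=> /(_ (conj erefl (almost_sub_refl S))) /(filterI (Wq S WS))/filter_ex.
by move=> [n [Sn [m Sm /branch_inj mn]]]; apply: Sm; rewrite mn.
Qed.

Lemma tree_card : card_continuum [set: I] -> card_continuum [set: tree].
Proof.
move=> cI; apply: Cantor_Bernstein.
  (* Points are coded by sets of sequences of integers, where the first entry
     is a tag: 0 for a node, 1 for a limit point, 2 for the elements of its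
     branch and 3 for those of its member of the tower. *)
  pose code (x : tree) : set (seq nat) := fun v =>
    match x, v with
    | Node s, [:: 0; n] => n = pickle s
    | Limit _ _ _, [:: 1] => True
    | Limit a _ _, [:: 2; n] => c a n
    | Limit _ T _, [:: 3; n] => T n
    | _, _ => False
    end.
  have code_inj : injective code.
    move=> x y xy; have {xy} eqv v : code x v = code y v by rewrite xy.
    case: x y eqv => [s|a S WS|] [t|b S' WS'|] eqv //.
    - have := eqv [:: 0; pickle s]; rewrite /= => st.
      by congr Node; apply: (pcan_inj pickleK); rewrite -st.
    - by exfalso; have /= H := eqv [:: 1]; rewrite H.
    - by exfalso; have /= H := eqv [:: 0; pickle s]; rewrite -H.
    - by exfalso; have /= H := eqv [:: 1]; rewrite -H.
    - have /c_inj ab : c a = c b by apply/funext => n; exact: (eqv [:: 2; n]).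
      by subst b; apply: eq_Limit; apply/funext => n; exact: (eqv [:: 3; n]).
    - by exfalso; have /= H := eqv [:: 1]; rewrite -H.
    - by exfalso; have /= H := eqv [:: 0; pickle t]; rewrite H.
    - by exfalso; have /= H := eqv [:: 1]; rewrite H.
  apply: (card_ge_preimage (B := setT) (f := fun x => pickle @` code x)).
  move=> x y _ _ xy; apply: code_inj; apply/funext => v.
  have pickle_inj := pcan_inj (@pickleK (seq nat)).
  by rewrite -(image_inj (A := code x) pickle_inj) xy image_inj.
rewrite -(card_le_eql cI).
have /choice[S WS] a : exists S, W a S.
  have [||S WS _] := tower_countable _ (W_tower a) set0; first by [].
    exact: countable0.
  by exists S.
apply: (card_ge_preimage (B := setT)
  (f := fun a => Limit a (S a) (WS a) : tree)).
by move=> a b _ _ [].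
Qed.

End tower_tree.

Theorem theorem3p1 (I : Type) (cI : card_continuum [set: I])
    (p : I -> set_system nat)
    (p_Ppoint : forall a : I, P_point (p a))
    (p_char : forall a : I, character_omega1 (p a))
    (p_image : forall u : set_system nat, nonprincipal_ultrafilter u ->
       exists (f : nat -> nat) (a : I), finite_to_one f /\ f @ u = p a) :
  exists X : topologicalType,
    [/\ separable X,
        sequentially_compact X,
        hausdorff_space X,
        card_continuum [set: X] &
        forall q : set_system nat,
          nonprincipal_ultrafilter q -> ~ p_compact q X].
Proof.
have [c c_inj] : exists c : I -> set nat, injective c.
  have /card_eqPle[/pcard_injP[c c_inj] _] := cI.
  by exists c => a b; apply: c_inj; exact: mem_set.
have /choice[W WP] a : exists Wa, tower Wa /\ Wa `<=` p a.
  by have [Wa ? ?] := P_point_tower (p_Ppoint a) (p_char a); exists Wa.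
have W_tower a : tower (W a) by have [] := WP a.
exists (tree I c W : topologicalType); split.
- exact: tree_separable.
- exact: tree_sequentially_compact.
- exact: tree_hausdorff.
- exact: tree_card.
- move=> q qnp qX; have [f [a [_ fqa]]] := p_image q qnp.
  have [l ql] := qX (fun n => Node I W (branch (c a) (f n))).
  apply: (branch_no_p_limit I c W a (p a) l (p_Ppoint a).1 (WP a).2).
  by rewrite -fqa; exact: ql.
Qed.
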